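(* Let $(G,d_G)$ and $(H,d_H)$ be topological groups with compatible two-sided invariant ultrametrics, and let $A=G\cap H$ be a common closed subgroup on which $d_G$ and $d_H$ agree. Let $d$ be the ultrametric amalgam of $d_G$ and $d_H$ on $G\cup H$ over $A$, and let $\delta$ be the Graev ultrametric on the amalgamated free product $G*_A H$, i.e. $$\delta(f_1,f_2)=\inf\{\rho(u_1,u_2) : u_1,u_2\in \mathrm{W}(G\cup H),\ \hat u_1=f_1,\ \hat u_2=f_2,\ |u_1|=|u_2|\}.$$ Then $\delta$ is a two-sided invariant ultrametric on $G*_A H$. Moreover, $\delta$ extends $d$ on $G\cup H$, i.e. $\delta(x,y)=d(x,y)$ for all $x,y\in G\cup H\subseteq G*_AH$.
   Context: An ultrametric is a metric with $d(x_1,x_2)\le\max\{d(x_1,x_3),d(x_3,x_2)\}$. A metric on a group is two-sided invariant if it is invariant under all left and all right translations; it is compatible if it induces the topology of the group. $A=G\cap H$ is a subgroup of both $G$ and $H$ (the group operations of $G$ and $H$ agree on $A$), it is closed in both, and $d_G(a_1,a_2)=d_H(a_1,a_2)$ for $a_1,a_2\in A$. The ultrametric amalgam $d$ on $G\cup H$ over $A$ is the ultrametric extending $d_G$ and $d_H$ with $d(g,h)=d(h,g)=\inf_{a\in A}\max\{d_G(g,a),d_H(a,h)\}$ for $g\in G$, $h\in H$. $\mathrm{W}(G\cup H)$ is the set of nonempty finite words in the alphabet $G\cup H$; $|w|$ is the length of $w$ and $w(i)$ its $i$th letter; $\hat w\in G*_AH$ is the product of the letters of $w$. $G$ and $H$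 are viewed as subgroups of $G*_A H$. For words $u_1,u_2$ of the same length $n$, $\rho(u_1,u_2)=\max_{1\le i\le n} d(u_1(i),u_2(i))$. *)

(* Defs.v *)
From HB Require Import structures.
From mathcomp Require Import all_boot all_order all_algebra.
From mathcomp Require Import boolp classical_sets reals topology.

Set Implicit Arguments.
Unset Strict Implicit.
Unset Printing Implicit Defensive.

Import Order.TTheory GRing.Theory Num.Theory.
Local Open Scope classical_set_scope.
Local Open Scope quotient_scope.
Local Open Scope ring_scope.

HB.mixin Record Group_isTopological G of Group G & Topological G := {
  mulg_continuous : continuous (fun xy : G * G => (xy.1 * xy.2)%g);
  invg_continuous : continuous (fun x : G => x^-1%g)
}.

#[short(type="topologicalGroupType")]
HB.structure Definition TopologicalGroup :=
  {G of Group G & Topological G & Group_isTopological G}.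

Section Metrics.
Variable R : realType.

Record is_ultrametric (T : Type) (d : T -> T -> R) : Prop := IsUltrametric {
  um_ge0 : forall x y, 0 <= d x y;
  um_eq0 : forall x y, d x y = 0 <-> x = y;
  um_sym : forall x y, d x y = d y x;
  um_le_max : forall x y z, d x y <= Num.max (d x z) (d z y)
}.

Definition two_sided_invariant (G : groupType) (d : G -> G -> R) : Prop :=
  (forall g x y, d (g * x)%g (g * y)%g = d x y) /\
  (forall g x y, d (x * g)%g (y * g)%g = d x y).

Definition compatible_metric (T : topologicalType) (d : T -> T -> R) : Prop :=
  forall x : T,
    nbhs x = filter_from [set e : R | 0 < e] (fun e => [set y | d x y < e]).

End Metrics.

(* Two groups G and H whose set-theoretic intersection is a common subgroup.
   Types do not overlap, so the set G `|` H is a carrier into which both groups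
   inject with jointly surjective images; "g and h are the same element" reads
   inG g = inH h. The last three fields say that the intersection is closed
   under the operations of G and of H, and that these operations agree there. *)
Record group_amalgam (G H : groupType) := GroupAmalgam {
  amalgam_union :> choiceType;
  inG : G -> amalgam_union;
  inH : H -> amalgam_union;
  inG_inj : injective inG;
  inH_inj : injective inH;
  in_union : forall x, range inG x \/ range inH x;
  amalgam1 : inG 1%g = inH 1%g;
  amalgamM : forall g1 g2 h1 h2, inG g1 = inH h1 -> inG g2 = inH h2 ->
    inG (g1 * g2)%g = inH (h1 * h2)%g;
  amalgamV : forall g h, inG g = inH h -> inG g^-1%g = inH h^-1%g
}.

Arguments inG {G H} U g : rename.
Arguments inH {G H} U h : rename.

Definition amalgam_inter (G H : groupType) (U : group_amalgam G H) : set U :=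
  range (inG U) `&` range (inH U).

Arguments amalgam_inter {G H} U _.

Section AmalgamatedProduct.
Variables (G H : groupType) (U : group_amalgam G H).
Implicit Types (x y : U) (u v w : seq U).

(* The congruence on the free monoid over G `|` H generated by the
   multiplication tables of G and of H. *)
Inductive word_cong : seq U -> seq U -> Prop :=
| word_cong_refl u : word_cong u u
| word_cong_sym u v : word_cong u v -> word_cong v u
| word_cong_trans v u w : word_cong u v -> word_cong v w -> word_cong u w
| word_cong_cat u1 u2 v1 v2 :
    word_cong u1 v1 -> word_cong u2 v2 -> word_cong (u1 ++ u2) (v1 ++ v2)
| word_cong_1 : word_cong [:: inG U 1%g] [::]
| word_cong_G g1 g2 : word_cong [:: inG U g1; inG U g2] [:: inG U (g1 * g2)%g]
| word_cong_H h1 h2 : word_cong [:: inH U h1; inH U h2] [:: inH U (h1 * h2)%g].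

Definition word_congb u v : bool := `[< word_cong u v >].

Fact word_congb_refl : reflexive word_congb.
Proof. by move=> u; apply/asboolP; apply: word_cong_refl. Qed.
Fact word_congb_sym : symmetric word_congb.
Proof. by move=> u v; apply/asboolP/asboolP; apply: word_cong_sym. Qed.
Fact word_congb_trans : transitive word_congb.
Proof.
by move=> v u w /asboolP uv /asboolP vw; apply/asboolP; apply: word_cong_trans uv vw.
Qed.

Canonical word_cong_equiv :=
  EquivRel word_congb word_congb_refl word_congb_sym word_congb_trans.

Definition amalgamated_product := {eq_quot word_cong_equiv}.

HB.instance Definition _ := Choice.on amalgamated_product.
HB.instance Definition _ := Quotient.on amalgamated_product.

Local Notation P := amalgamated_product.

Definition word_class (u : seq U) : P := \pi u.

Lemma word_classP u v : word_class u = word_class v <-> word_cong u v.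
Proof.
split=> [/eqP|uv]; first by rewrite /word_class piE => /asboolP.
by apply/eqP; rewrite /word_class piE; apply/asboolP.
Qed.

Lemma word_class_surj (p : P) : exists u, p = word_class u.
Proof. by exists (repr p); rewrite /word_class reprK. Qed.

Lemma word_cong_repr u : word_cong (repr (word_class u)) u.
Proof. by apply/word_classP; rewrite /word_class reprK. Qed.

Definition letter_inv x : U := xget x
  [set y | (exists2 g, x = inG U g & y = inG U g^-1%g) \/
           (exists2 h, x = inH U h & y = inH U h^-1%g)].

Lemma letter_invG g : letter_inv (inG U g) = inG U g^-1%g.
Proof.
apply: xget_unique; first by left; exists g.
by move=> y [[g' /inG_inj -> ->]|[h /amalgamV -> ->]].
Qed.

Lemma letter_invH h : letter_inv (inH U h) = inH U h^-1%g.
Proof.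
apply: xget_unique; first by right; exists h.
by move=> y [[g /esym /amalgamV <- ->]|[h' /inH_inj -> ->]].
Qed.

Definition word_inv u := rev [seq letter_inv x | x <- u].

Lemma word_inv_cat u v : word_inv (u ++ v) = word_inv v ++ word_inv u.
Proof. by rewrite /word_inv map_cat rev_cat. Qed.

Lemma word_cong_inv u v : word_cong u v -> word_cong (word_inv u) (word_inv v).
Proof.
elim=> {u v}.
- by move=> u; apply: word_cong_refl.
- by move=> u v _; apply: word_cong_sym.
- by move=> v u w _ uv _; apply: word_cong_trans uv.
- by move=> u1 u2 v1 v2 _ uv1 _ uv2; rewrite !word_inv_cat; apply: word_cong_cat.
- by rewrite /word_inv/= letter_invG invg1; apply: word_cong_1.
- move=> g1 g2; rewrite /word_inv/= !letter_invG invgM.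
  exact: word_cong_G.
- move=> h1 h2; rewrite /word_inv/= !letter_invH invgM.
  exact: word_cong_H.
Qed.

Lemma letter_mulV x : word_cong [:: x; letter_inv x] [::].
Proof.
have [[g _ <-]|[h _ <-]] := in_union x.
  rewrite letter_invG; apply: word_cong_trans (word_cong_G _ _) _.
  by rewrite mulgV; apply: word_cong_1.
rewrite letter_invH; apply: word_cong_trans (word_cong_H _ _) _.
by rewrite mulgV -amalgam1; apply: word_cong_1.
Qed.

Lemma letter_invK x : letter_inv (letter_inv x) = x.
Proof.
by have [[g _ <-]|[h _ <-]] := in_union x; rewrite ?letter_invG ?letter_invH invgK.
Qed.

Lemma word_mulV u : word_cong (u ++ word_inv u) [::].
Proof.
elim: u => [|x u IHu]; first exact: word_cong_refl.
rewrite /word_inv/= rev_cons -cats1 -/(word_inv u) catA.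
apply: word_cong_trans (letter_mulV x).
rewrite -[x :: _]/([:: x] ++ (_ ++ _)) -[[:: x; _]]/([:: x] ++ ([::] ++ [:: _])).
by do 2![apply: word_cong_cat => //; try exact: word_cong_refl].
Qed.

Lemma word_invK u : word_inv (word_inv u) = u.
Proof. by rewrite /word_inv map_rev revK -map_comp map_id_in// => x _ /=; rewrite letter_invK. Qed.

Lemma word_mulVl u : word_cong (word_inv u ++ u) [::].
Proof. by rewrite -{2}[u]word_invK; apply: word_mulV. Qed.

Definition ap_one : P := word_class [::].
Definition ap_mul (p q : P) : P := word_class (repr p ++ repr q).
Definition ap_inv (p : P) : P := word_class (word_inv (repr p)).

Lemma ap_mulE u v : ap_mul (word_class u) (word_class v) = word_class (u ++ v).
Proof. by apply/word_classP; apply: word_cong_cat; apply: word_cong_repr. Qed.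

Lemma ap_invE u : ap_inv (word_class u) = word_class (word_inv u).
Proof. by apply/word_classP; apply: word_cong_inv; apply: word_cong_repr. Qed.

Fact ap_mulA : associative ap_mul.
Proof.
move=> p q r; have [[u ->] [v ->] [w ->]] :=
  And3 (word_class_surj p) (word_class_surj q) (word_class_surj r).
by rewrite !ap_mulE catA.
Qed.
Fact ap_mul1g : left_id ap_one ap_mul.
Proof. by move=> p; have [u ->] := word_class_surj p; rewrite ap_mulE. Qed.
Fact ap_mulg1 : right_id ap_one ap_mul.
Proof. by move=> p; have [u ->] := word_class_surj p; rewrite ap_mulE cats0. Qed.
Fact ap_mulVl : left_inverse ap_one ap_inv ap_mul.
Proof.
move=> p; have [u ->] := word_class_surj p; rewrite ap_invE ap_mulE.
by apply/word_classP; apply: word_mulVl.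
Qed.
Fact ap_mulVr : right_inverse ap_one ap_inv ap_mul.
Proof.
move=> p; have [u ->] := word_class_surj p; rewrite ap_invE ap_mulE.
by apply/word_classP; apply: word_mulV.
Qed.

HB.instance Definition _ :=
  isGroup.Build P ap_mulA ap_mul1g ap_mulg1 ap_mulVl ap_mulVr.

(* The canonical map from G `|` H to the amalgamated product, along which
   G and H are viewed as subgroups of it. *)
Definition letter x : P := word_class [:: x].

(* \hat w *)
Definition word_prod (w : seq U) : P := (\prod_(x <- w) letter x)%g.

Lemma word_prodE w : word_prod w = word_class w.
Proof.
rewrite /word_prod; elim: w => [|x w IHw]; first by rewrite big_nil.
by rewrite big_cons IHw; apply: ap_mulE.
Qed.

Lemma letterG : {morph (fun g => letter (inG U g)) : g1 g2 / (g1 * g2)%g}.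
Proof.
move=> g1 g2; rewrite [RHS]ap_mulE; apply/word_classP.
by apply: word_cong_sym; apply: word_cong_G.
Qed.

Lemma letterH : {morph (fun h => letter (inH U h)) : h1 h2 / (h1 * h2)%g}.
Proof.
move=> h1 h2; rewrite [RHS]ap_mulE; apply/word_classP.
by apply: word_cong_sym; apply: word_cong_H.
Qed.

(* The universal property of the free product with amalgamation. *)
Theorem amalgamated_product_univ (K : groupType) (f : G -> K) (k : H -> K) :
    {morph f : x y / (x * y)%g} -> {morph k : x y / (x * y)%g} ->
    (forall g h, inG U g = inH U h -> f g = k h) ->
  exists! F : P -> K, [/\ {morph F : p q / (p * q)%g},
    forall g, F (letter (inG U g)) = f g & forall h, F (letter (inH U h)) = k h].
Proof.
move=> fM kM fk.
have f1 : f 1%g = 1%g by apply: (mulgI (f 1%g)); rewrite -fM !mulg1.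
pose phi x := xget 1%g [set z | (exists2 g, x = inG U g & z = f g) \/
                                (exists2 h, x = inH U h & z = k h)].
have phiG g : phi (inG U g) = f g.
  apply: xget_unique; first by left; exists g.
  by move=> y [[g' /inG_inj -> ->]|[h /fk -> ->]].
have phiH h : phi (inH U h) = k h.
  apply: xget_unique; first by right; exists h.
  by move=> y [[g /esym /fk <- ->]|[h' /inH_inj -> ->]].
pose Phi w : K := (\prod_(x <- w) phi x)%g.
have Phi_cong u v : word_cong u v -> Phi u = Phi v.
  elim=> {u v} //.
  - by move=> v u w _ -> _ ->.
  - by move=> u1 u2 v1 v2 _ e1 _ e2; rewrite /Phi !big_cat/=; congr (_ * _)%g.
  - by rewrite /Phi big_seq1 big_nil phiG.
  - by move=> g1 g2; rewrite /Phi big_cons !big_seq1 !phiG fM.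
  - by move=> h1 h2; rewrite /Phi big_cons !big_seq1 !phiH kM.
pose F (p : P) := Phi (repr p).
have FE u : F (word_class u) = Phi u by apply: Phi_cong; apply: word_cong_repr.
exists F; split.
  split=> [p q|g|h].
  - have [[u ->] [v ->]] := (word_class_surj p, word_class_surj q).
    by rewrite [(_ * _)%g]ap_mulE !FE /Phi big_cat.
  - by rewrite FE /Phi big_seq1 phiG.
  - by rewrite FE /Phi big_seq1 phiH.
move=> F' [F'M F'G F'H]; apply/funext => p.
have F'1 : F' 1%g = 1%g by apply: (mulgI (F' 1%g)); rewrite -F'M !mulg1.
have [u ->] := word_class_surj p; rewrite FE -word_prodE.
elim: u => [|x u IHu]; first by rewrite /Phi /word_prod !big_nil.
rewrite /Phi /word_prod !big_cons F'M -/(Phi u) IHu; congr (_ * _)%g.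
by have [[g _ <-]|[h _ <-]] := in_union x; rewrite ?F'G ?F'H ?phiG ?phiH.
Qed.

End AmalgamatedProduct.

Arguments letter {G H U} x.
Arguments word_prod {G H U} w.

Section Graev.
Variables (R : realType) (G H : groupType) (U : group_amalgam G H).

Section AmalgamMetric.
Variables (dG : G -> G -> R) (dH : H -> H -> R).

Definition unG (x : U) : G := xget 1%g [set g | inG U g = x].
Definition unH (x : U) : H := xget 1%g [set h | inH U h = x].

(* a.1 and a.2 are one and the same element of the intersection. *)
Definition amalgam_cross (g : G) (h : H) : R :=
  inf [set Num.max (dG g a.1) (dH a.2 h) |
       a in [set a : G * H | inG U a.1 = inH U a.2]].

Definition amalgam_dist (x y : U) : R :=
  if `[< range (inG U) x /\ range (inG U) y >] then dG (unG x) (unG y)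
  else if `[< range (inH U) x /\ range (inH U) y >] then dH (unH x) (unH y)
  else if `[< range (inG U) x >] then amalgam_cross (unG x) (unH y)
  else amalgam_cross (unG y) (unH x).

Hypothesis dG_um : is_ultrametric dG.
Hypothesis dH_um : is_ultrametric dH.
Hypothesis dGH : forall g1 g2 h1 h2, inG U g1 = inH U h1 -> inG U g2 = inH U h2 ->
  dG g1 g2 = dH h1 h2.

Lemma unGK g : unG (inG U g) = g.
Proof. by apply: xget_unique => // g' /inG_inj. Qed.

Lemma unHK h : unH (inH U h) = h.
Proof. by apply: xget_unique => // h' /inH_inj. Qed.

Lemma amalgam_cross_inf_min g h (r : R) :
  (exists2 a : G * H, inG U a.1 = inH U a.2 & r = Num.max (dG g a.1) (dH a.2 h)) ->
  (forall a b, inG U a = inH U b -> r <= Num.max (dG g a) (dH b h)) ->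
  amalgam_cross g h = r.
Proof.
move=> [a aP rE] rmin; apply/eqP; rewrite eq_le; apply/andP; split.
  apply: ge_inf; last by exists a => //; rewrite rE.
  by exists r => _ [[b c] /= bc <-]; apply: rmin.
apply: lb_le_inf; first by exists r; exists a => //; rewrite rE.
by move=> _ [[b c] /= bc <-]; apply: rmin.
Qed.

Let rangeG g : range (inG U) (inG U g).
Proof. by exists g. Qed.

Let rangeH h : range (inH U) (inH U h).
Proof. by exists h. Qed.

Lemma amalgam_dist_GG g1 g2 : amalgam_dist (inG U g1) (inG U g2) = dG g1 g2.
Proof. by rewrite /amalgam_dist asboolT ?unGK ?unGK. Qed.

Lemma amalgam_dist_HH h1 h2 : amalgam_dist (inH U h1) (inH U h2) = dH h1 h2.
Proof.
rewrite /amalgam_dist; case: asboolP => [[[g1 _ e1] [g2 _ e2]]|_].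
  by rewrite -e1 -e2 !unGK; apply: dGH.
by rewrite asboolT ?unHK ?unHK.
Qed.

Lemma amalgam_dist_GH g h : amalgam_dist (inG U g) (inH U h) = amalgam_cross g h.
Proof.
rewrite /amalgam_dist; case: asboolP => [[_ [a _ ah]]|nG].
  rewrite unGK -ah unGK; apply/esym/amalgam_cross_inf_min.
    exists (a, h) => //=; rewrite (um_eq0 dH_um h h).2// max_l//.
    exact: (um_ge0 dG_um).
  by move=> b c bc; rewrite -(dGH bc ah); apply: (um_le_max dG_um).
case: asboolP => [[[b _ bg] _]|nH].
  rewrite unHK -bg unHK; apply/esym/amalgam_cross_inf_min.
    exists (g, b) => //=; rewrite (um_eq0 dG_um g g).2// max_r//.
    exact: (um_ge0 dH_um).
  by move=> a c ac; rewrite (dGH (esym bg) ac); apply: (um_le_max dH_um).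
by rewrite asboolT ?unGK ?unHK.
Qed.

Lemma amalgam_dist_HG g h : amalgam_dist (inH U h) (inG U g) = amalgam_cross g h.
Proof.
have [[a _ ah]|nG] := pselect (range (inG U) (inH U h)).
  rewrite -ah amalgam_dist_GG (um_sym dG_um) -amalgam_dist_GG ah.
  exact: amalgam_dist_GH.
have [[b _ bg]|nH] := pselect (range (inH U) (inG U g)).
  rewrite -bg amalgam_dist_HH (um_sym dH_um) -amalgam_dist_HH bg.
  exact: amalgam_dist_GH.
by rewrite /amalgam_dist !asboolF ?unGK ?unHK// => -[].
Qed.

End AmalgamMetric.

(* Meant for words of equal length, as zip truncates; the value 0 at the empty
   word plays no role when d >= 0 and the words are nonempty. *)
Definition word_dist (d : U -> U -> R) (u1 u2 : seq U) : R :=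
  \big[Num.max/0]_(p <- zip u1 u2) d p.1 p.2.

Definition graev_dist (d : U -> U -> R) (f1 f2 : amalgamated_product U) : R :=
  inf [set r | exists u1 u2 : seq U,
    [/\ u1 != [::] /\ u2 != [::], word_prod u1 = f1, word_prod u2 = f2,
        size u1 = size u2 & r = word_dist d u1 u2]].

End Graev.

Arguments amalgam_dist {R G H} U dG dH x y.
Arguments graev_dist {R G H U} d f1 f2.

(* Main.v *)
Require Import Defs.
From HB Require Import structures.
From mathcomp Require Import all_boot all_order all_algebra.
From mathcomp Require Import boolp classical_sets reals topology.

Set Implicit Arguments.
Unset Strict Implicit.
Unset Printing Implicit Defensive.

Import Order.TTheory GRing.Theory Num.Theory.

(** The soft half of the theorem comes from concatenating words: if
    [delta f1 g1 < r] and [delta f2 g2 < r] then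
    [delta (f1 * f2) (g1 * g2) < r] ([graev_distM]).  As [delta f f = 0], this
    yields two-sided invariance, and also the ultrametric inequality, by writing
    [f = (f h^-1) h] and [g = 1 g] up to right translation by [h].

    The hard half consists of the lower bound [d x y <= delta x y] on letters
    and of [delta f g = 0 -> f = g].  For [r > 0] the open balls of radius [r]
    around [1] are normal subgroups [NG] and [NH] of [G] and [H], because the
    metrics are ultrametric and two-sided invariant, and they meet [A] in the
    same subgroup [NA].  The amalgam of [G/NG] and [H/NH] over [A/NA] is then a
    quotient of the amalgam of [G] and [H] in which letters at distance less
    than [r] become equal, so that [delta f g < r] makes [f] and [g] equal in it.
    - Since [G/NG] and [H/NH] embed in their amalgam and meet there in [A/NA],
      two letters that become equal are at distance less than [r]; taking
      [r = d x y] shows that [delta x y < d x y] is impossible.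
    - If [f <> 1] is not a single letter, it is the product of a reduced word,
      whose letters are outside [A] and alternate between the two groups.  As [A]
      is closed, for [r] small enough all letters remain outside [A NG] and
      [A NH]; the image of the word is again reduced, hence not trivial, and so
      [r <= delta f 1].

    Both facts about the quotient amalgam come from van der Waerden's action of
    words on normal forms.  The quotient groups are never formed: [E x y], which
    is [d x y < r], is carried along as a congruence on each factor.  A normal
    form is a pair [(q, a)], where [q] is an alternating sequence of nontrivial
    representatives of cosets of [A NG] or of [A NH], and [a] in [A] is a chosen
    representative of its class modulo [NA].  It stands for the product of [a] with
    the letters of [q] on its left, the last letter being the head of [q]; words
    act by right multiplication.  The action respects the defining relations of the
    amalgam ([word_act_cong]) and the congruence ([word_act_near]); it separates
    letters that are not congruent ([base_separates]), and reduced words with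
    letters away from [A] lengthen the normal form ([word_act_reduced]). *)

Local Open Scope classical_set_scope.
Local Open Scope ring_scope.

(** * Normal forms seen from one factor *)

Section Factor.
Local Open Scope group_scope.
Variables (U : choiceType) (A : set U) (E : U -> U -> Prop).
Variables (K : groupType) (i : K -> U).
Implicit Types (x y z k s : K) (q : seq U) (a : U) (st : seq U * U).

(** A group [K] embedded by [i] in a set [U] which contains the other factor as
    well, with the amalgamated subgroup given as a subset [A] of [U], and with [E]
    restricting to a congruence of [K]; thus [E] stands for equality modulo a
    normal subgroup [N].  Keeping [A] and [E] on [U] makes them the same objects
    for both factors. *)
Record congruent_factor : Prop := CongruentFactor {
  factor_inj : injective i;
  factor_range : forall a, A a -> range i a;
  factor1 : A (i 1);
  factorM : forall x y, A (i x) -> A (i y) -> A (i (x * y));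
  factorV : forall x, A (i x) -> A (i x^-1);
  factor_refl : forall x, E (i x) (i x);
  factor_sym : forall x y, E (i x) (i y) -> E (i y) (i x);
  factor_trans : forall x y z, E (i x) (i y) -> E (i y) (i z) -> E (i x) (i z);
  factor_mull : forall z x y, E (i x) (i y) -> E (i (z * x)) (i (z * y));
  factor_mulr : forall z x y, E (i x) (i y) -> E (i (x * z)) (i (y * z))
}.

(** The coset [x A N]. *)
Definition thick_coset x : set K :=
  [set z | exists2 k, A (i k) & E (i x) (i (z * k))].

(** The choice depends only on the coset, and the representative of the trivial
    coset is [1], so that trivial letters can be recognised and dropped. *)
Definition coset_rep x : K :=
  if `[< thick_coset x 1 >] then 1 else xget 1 (thick_coset x).

(** The default value is a parameter because the two factors must be seen to
    choose the same representative; both take the common [1] for it. *)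
Definition canon_near (o a : U) : U := xget o [set b | A b /\ E a b].

(** The component of [x] in [A N / N], relative to the transversal. *)
Definition residue x : U := canon_near (i 1) (i ((coset_rep x)^-1 * x)).

Definition un_factor (a : U) : K := xget 1 [set k | i k = a].

(** Together with [tail_in], this writes a normal form as a coset representative
    in [K], equal to [1] when the leading letter is not in [K], in front of a
    sequence which does not start in [K].  The set of all normal forms is thereby a
    disjoint union of copies of [K/N], on which [K] acts by translations. *)
Definition head_in q : K := if q is a :: _ then un_factor a else 1.

Definition tail_in q : seq U :=
  if q is a :: q' then (if `[< range i a >] then q' else q) else [::].

Definition cons_in s q : seq U := if s == 1 then q else i s :: q.

Definition head_out q : Prop := if q is a :: _ then ~ range i a else True.

Definition rep_letter (a : U) : Prop :=
  exists s, [/\ a = i s, coset_rep s = s & s <> 1].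

Definition splits q : Prop :=
  [/\ coset_rep (head_in q) = head_in q, head_out (tail_in q) &
      q = cons_in (head_in q) (tail_in q)].

(** Right translation by [k]: the last coset representative, the [A] component
    and [k] are multiplied in [K], and the product is decomposed again. *)
Definition factor_act k st : seq U * U :=
  let y := head_in st.1 * un_factor st.2 * k in
  (cons_in (coset_rep y) (tail_in st.1), residue y).

Hypothesis F : congruent_factor.

Let Er := factor_refl F.
Let Es := factor_sym F.
Let Et := factor_trans F.
Let El := factor_mull F.
Let ER := factor_mulr F.

Lemma un_factorK k : un_factor (i k) = k.
Proof. by apply: xget_unique => // k' /(factor_inj F). Qed.

(** The default value matters: an alternating sequence which starts in the other
    group has the trivial representative as its head. *)
Lemma un_factor_out a : ~ range i a -> un_factor a = 1.
Proof. by move=> na; apply: xgetPN => k ka; apply: na; exists k. Qed.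

Lemma thick_coset_refl x : thick_coset x x.
Proof. by exists 1; [exact: factor1|rewrite mulg1; exact: Er]. Qed.

Lemma thick_cosetE x z : thick_coset x z -> thick_coset x = thick_coset z.
Proof.
move=> [k Ak xz]; apply/funext => w; apply/propext; split=> -[l Al h].
  exists (l * k^-1); first by apply: factorM => //; apply: factorV.
  by rewrite mulgA -[z](mulgK k); apply: ER; apply: Et (Es xz) h.
exists (l * k); first exact: factorM.
by rewrite mulgA; apply: Et xz _; apply: ER.
Qed.

Lemma thick_coset_near x y : E (i x) (i y) -> thick_coset x = thick_coset y.
Proof. by move=> xy; apply: thick_cosetE; exists 1; [exact: factor1|rewrite mulg1]. Qed.

Lemma thick_coset_mulr x k : A (i k) -> thick_coset (x * k) = thick_coset x.
Proof. by move=> Ak; apply: thick_cosetE; exists k. Qed.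

Lemma coset_rep_mem x : thick_coset x (coset_rep x).
Proof.
rewrite /coset_rep; case: asboolP => // _.
by apply: xgetPex; exists x; apply: thick_coset_refl.
Qed.

Lemma coset_rep_eq x y : thick_coset x = thick_coset y -> coset_rep x = coset_rep y.
Proof. by rewrite /coset_rep => ->. Qed.

Lemma coset_rep_idem x : coset_rep (coset_rep x) = coset_rep x.
Proof.
by apply: esym; apply: coset_rep_eq; apply: thick_cosetE; apply: coset_rep_mem.
Qed.

Lemma coset_rep_eq1 x : thick_coset x 1 <-> coset_rep x = 1.
Proof.
split=> [h|<-]; first by rewrite /coset_rep asboolT.
exact: coset_rep_mem.
Qed.

Lemma coset_rep1 : coset_rep 1 = 1.
Proof. by apply/coset_rep_eq1/thick_coset_refl. Qed.

Lemma canon_near_eq o x y : E (i x) (i y) -> canon_near o (i x) = canon_near o (i y).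
Proof.
move=> xy; rewrite /canon_near; congr xget.
apply/funext => b; apply/propext; split=> -[Ab h]; split=> //;
  have [k _ kb] := factor_range F Ab; subst b.
- by apply: Et h; apply: Es.
- by apply: Et h.
Qed.

Lemma residue_near x y : E (i x) (i y) -> residue x = residue y.
Proof.
move=> xy; rewrite /residue (coset_rep_eq (thick_coset_near xy)).
by apply: canon_near_eq; apply: El.
Qed.

Lemma residue_mem x : A (residue x) /\ E (i ((coset_rep x)^-1 * x)) (residue x).
Proof.
have [k Ak xk] := coset_rep_mem x.
pose near_res := [set b | A b /\ E (i ((coset_rep x)^-1 * x)) b].
suff: near_res (residue x) by [].
apply: xgetPex; exists (i k); split=> //.
by rewrite -(mulKg (coset_rep x) k); apply: El.
Qed.

(** Residues are fixed by the choice of representatives, so the action stays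
    within normal forms and equality of normal forms can be plain equality. *)
Lemma residue_canon x : canon_near (i 1) (residue x) = residue x.
Proof.
have [Ar] := residue_mem x; have [k _ kr] := factor_range F Ar.
rewrite -kr => h; rewrite -(canon_near_eq _ h); by rewrite kr.
Qed.

Lemma coset_rep_residue x :
  E (i x) (i (coset_rep x * un_factor (residue x))).
Proof.
have [Ar] := residue_mem x; have [k _ kr] := factor_range F Ar.
rewrite -kr un_factorK => h.
by rewrite -{1}(mulVKg (coset_rep x) x); apply: El.
Qed.

Lemma head_in_cons s q : head_out q -> head_in (cons_in s q) = s.
Proof.
rewrite /cons_in; case: eqP => [->|_ _]; last by rewrite /= un_factorK.
by case: q => [|a q] //= na; rewrite un_factor_out.
Qed.

Lemma tail_in_cons s q : head_out q -> tail_in (cons_in s q) = q.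
Proof.
rewrite /cons_in; case: eqP => [_|_ _]; last by rewrite /= asboolT//; exists s.
by case: q => [|a q] //= na; rewrite asboolF.
Qed.

Lemma factor_actM x y st : splits st.1 ->
  factor_act y (factor_act x st) = factor_act (x * y) st.
Proof.
move=> [_ ho _]; rewrite /factor_act/= head_in_cons// tail_in_cons//.
set z := _ * x; have zE : E (i (coset_rep z * un_factor (residue z) * y))
    (i (head_in st.1 * un_factor st.2 * (x * y))).
  by rewrite mulgA; apply: ER; apply: Es; apply: coset_rep_residue.
by rewrite (coset_rep_eq (thick_coset_near zE)) (residue_near zE).
Qed.

Lemma factor_act_near x y st : E (i x) (i y) -> factor_act x st = factor_act y st.
Proof.
move=> xy; have h := El (head_in st.1 * un_factor st.2) xy.
by rewrite /factor_act (coset_rep_eq (thick_coset_near h)) (residue_near h).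
Qed.

(** The right-hand side mentions [K] only through the product in [A]: this is why
    the actions of the two groups agree on the amalgamated subgroup. *)
Lemma factor_act_common k st : splits st.1 -> A st.2 -> A (i k) ->
  factor_act k st = (st.1, canon_near (i 1) (i (un_factor st.2 * k))).
Proof.
move=> [hr ho qE] Aa Ak; have [l _ la] := factor_range F Aa.
rewrite /factor_act /residue -la un_factorK.
have -> : coset_rep (head_in st.1 * l * k) = head_in st.1.
  rewrite -[RHS]hr; apply: coset_rep_eq.
  by rewrite !thick_coset_mulr // la.
by rewrite -mulgA mulKg -qE.
Qed.

Lemma rep_letter_out a : rep_letter a -> ~ A a.
Proof.
move=> [s [-> sr s1]] As; apply: s1; rewrite -sr; apply/coset_rep_eq1.
by exists s => //; rewrite mul1g; apply: Er.
Qed.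

Lemma splits_cons a q : rep_letter a -> head_out q -> splits (a :: q).
Proof.
move=> [s [-> sr /eqP s1]] ho; have -> : i s :: q = cons_in s q.
  by rewrite /cons_in (negPf s1).
by split; rewrite ?head_in_cons ?tail_in_cons.
Qed.

Lemma splits_out q : head_out q -> splits q.
Proof.
move=> ho; have q1 : cons_in 1 q = q by rewrite /cons_in eqxx.
have hd1 : head_in q = 1 by rewrite -q1 head_in_cons.
have tlq : tail_in q = q by rewrite -{1}q1 tail_in_cons.
by rewrite /splits hd1 tlq q1 coset_rep1.
Qed.

Lemma head_in_out q : head_out q -> head_in q = 1.
Proof. by case: q => //= a q; apply: un_factor_out. Qed.

Lemma tail_in_out q : head_out q -> tail_in q = q.
Proof. by case: q => //= a q na; rewrite asboolF. Qed.

(** On the empty sequence the action reads off the decomposition of [k] itself. *)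
Lemma factor_act_base k a : A a -> E (i 1) a ->
  factor_act k ([::], a) = (cons_in (coset_rep k) [::], residue k).
Proof.
move=> Aa; have [l _ <-] := factor_range F Aa => l1.
rewrite /factor_act/= un_factorK mul1g.
have h : E (i (l * k)) (i k) by rewrite -[k in X in E _ X]mul1g; apply/ER/Es.
by rewrite (coset_rep_eq (thick_coset_near h)) (residue_near h).
Qed.

(** The element [a k] by which [k] acts here lies outside [A N], so its coset
    representative is a new nontrivial letter. *)
Lemma factor_act_far k st : head_out st.1 -> A st.2 ->
    ~ (exists2 a, A a & E (i k) a) ->
  exists2 b, rep_letter b & (factor_act k st).1 = b :: st.1.
Proof.
move=> ho Aa far; have [l _ la] := factor_range F Aa.
rewrite /factor_act /= head_in_out// tail_in_out// -la un_factorK mul1g.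
have r1 : coset_rep (l * k) <> 1.
  move=> /coset_rep_eq1[m Am]; rewrite mul1g => h; apply: far.
  exists (i (l^-1 * m)).
    by apply: factorM => //; apply: factorV => //; rewrite la.
  by rewrite -(mulKg l k); apply: El.
exists (i (coset_rep (l * k))); last by rewrite /cons_in; case: eqP.
by exists (coset_rep (l * k)); split=> //; apply: coset_rep_idem.
Qed.

End Factor.

(** * Reduced words *)

Section ReducedWords.
Variables (G H : groupType) (U : group_amalgam G H).
Implicit Types (x y : U) (u v : seq U).

Definition same_factor x y : Prop :=
  range (inG U) x /\ range (inG U) y \/ range (inH U) x /\ range (inH U) y.

Definition switches x y : bool := ~~ `[< same_factor x y >].

Lemma word_prod_cat u v : word_prod (u ++ v) = (word_prod u * word_prod v)%g.
Proof. by rewrite /word_prod big_cat. Qed.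

Lemma word_prod_cons x u : word_prod (x :: u) = (letter x * word_prod u)%g.
Proof. by rewrite /word_prod big_cons. Qed.

Lemma same_factor_merge x y : same_factor x y ->
  exists z, (letter x * letter y)%g = letter z.
Proof.
move=> [] [] [a _ <-] [b _ <-].
  by exists (inG U (a * b)%g); rewrite letterG.
by exists (inH U (a * b)%g); rewrite letterH.
Qed.

(** Two neighbours in the same group can be replaced by their product, so a
    shortest word for a given element has no such neighbours. *)
Lemma sorted_or_shorter u : sorted switches u \/
  exists2 v, (size v < size u)%N & word_prod v = word_prod u.
Proof.
elim: u => [|x u [srt|[v vu vE]]]; first by left.
  case: u srt => [|y u] srt; first by left.
  have [/same_factor_merge[z zE]|n] := pselect (same_factor x y); last first.
    by left; move: srt; rewrite /= /switches asboolF.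
  by right; exists (z :: u) => //; rewrite !word_prod_cons -zE mulgA.
by right; exists (x :: v); rewrite ?word_prod_cons ?vE.
Qed.

Lemma reduced_word (f : amalgamated_product U) :
  exists2 u, sorted switches u & word_prod u = f.
Proof.
have [u ->] := word_class_surj f; rewrite -word_prodE.
have [n] := ubnP (size u); elim: n u => // n IHn u un.
have [srt|[v vu <-]] := sorted_or_shorter u; first by exists u.
by apply: IHn; apply: leq_trans vu _.
Qed.

Lemma same_factor_sym x y : same_factor x y -> same_factor y x.
Proof. by move=> [] []; [left|right]. Qed.

Lemma inter_same_factor x y : amalgam_inter U x -> same_factor x y.
Proof. by move=> [xG xH]; have [yG|yH] := in_union y; [left|right]. Qed.

(** A letter of [A] is in both groups, hence in a common group with either of its
    neighbours; only a word of length one can avoid having neighbours. *)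
Lemma switches_notin_inter x u : path switches x u -> u != [::] ->
  forall y, y \in x :: u -> ~ amalgam_inter U y.
Proof.
elim: u x => //= z u IHu x /andP[xz zu] _ y.
have ndiff : ~ same_factor x z by move: xz; rewrite /switches => /asboolPn.
rewrite in_cons => /orP[/eqP -> /(inter_same_factor z)//|].
case: u zu IHu => [_ _|t u zu IHu]; last by apply: IHu.
rewrite mem_seq1 => /eqP -> /(inter_same_factor x)/same_factor_sym.
exact: ndiff.
Qed.

End ReducedWords.

(** * The action of words on normal forms *)

Section WordAction.
Variables (G H : groupType) (U : group_amalgam G H) (E : U -> U -> Prop).
Local Open Scope group_scope.
Local Notation A := (amalgam_inter U).
Local Notation iG := (inG U).
Local Notation iH := (inH U).
Hypothesis FG : congruent_factor A E iG.
Hypothesis FH : congruent_factor A E iH.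
Hypothesis Esym : forall x y, E x y -> E y x.
(** Congruence across the factors is mediated by [A], as in the definition of the
    amalgamated distance. *)
Hypothesis EGH : forall g h,
  E (iG g) (iH h) <-> exists2 a, A a & E (iG g) a /\ E a (iH h).
Implicit Types (x y : U) (u v q : seq U) (st : seq U * U).

Definition letter_act x st : seq U * U :=
  if `[< range iG x >] then factor_act A E iG (un_factor iG x) st
  else factor_act A E iH (un_factor iH x) st.

Definition word_act u st : seq U * U := foldl (fun s x => letter_act x s) st u.

Fixpoint alternating q : Prop :=
  if q is a :: q' then
    (rep_letter A E iG a /\ head_out iG q' \/ rep_letter A E iH a /\ head_out iH q')
    /\ alternating q'
  else True.

Definition normal_state st : Prop :=
  [/\ alternating st.1, A st.2 & canon_near A E (iG 1) st.2 = st.2].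

(** A nontrivial representative is not in [A], so it belongs to one group only;
    this makes the two ways of splitting a sequence compatible. *)
Lemma rep_letterG_out x : rep_letter A E iG x -> ~ range iH x.
Proof.
by move=> xr xH; apply: (rep_letter_out FG xr); split=> //; case: xr => s [->]; exists s.
Qed.

Lemma rep_letterH_out x : rep_letter A E iH x -> ~ range iG x.
Proof.
by move=> xr xG; apply: (rep_letter_out FH xr); split=> //; case: xr => s [->]; exists s.
Qed.

Lemma alternating_splitsG q : alternating q -> splits A E iG q.
Proof.
case: q => [|a q] /=; first by move=> _; apply: splits_out.
move=> [[[ar ho]|[/rep_letterH_out an _]] _]; first exact: splits_cons.
exact: splits_out.
Qed.

Lemma alternating_splitsH q : alternating q -> splits A E iH q.
Proof.
case: q => [|a q] /=; first by move=> _; apply: splits_out.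
move=> [[[/rep_letterG_out an _]|[ar ho]] _]; last exact: splits_cons.
exact: splits_out.
Qed.

Lemma alternating_tail (K : groupType) (i : K -> U) q :
  alternating q -> alternating (tail_in i q).
Proof. by case: q => //= a q [h hq]; case: asboolP. Qed.

Lemma letter_actG g st : letter_act (iG g) st = factor_act A E iG g st.
Proof. by rewrite /letter_act asboolT ?(un_factorK FG)//; exists g. Qed.

(** [letter_act] gives precedence to [G]; the case of a letter in [A] is where the
    agreement of the two actions on [A] is used. *)
Lemma letter_actH h st : normal_state st ->
  letter_act (iH h) st = factor_act A E iH h st.
Proof.
move=> [alt As _]; rewrite /letter_act; case: asboolP => [[g _ gh]|_]; last first.
  by rewrite (un_factorK FH).
have [[b _ ba] [c _ ca]] := As.
rewrite -gh (un_factorK FG) (factor_act_common FG)//.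
- rewrite (factor_act_common FH)//.
  + rewrite -{1}ba -ca (un_factorK FG) (un_factorK FH) amalgam1.
    by rewrite (@amalgamM _ _ U _ _ c h) // ba ca.
  + exact: alternating_splitsH.
  + by split; [exists g|exists h].
- exact: alternating_splitsG.
- by split; [exists g|exists h; rewrite ?gh].
Qed.

Lemma factor_actG_normal g st : normal_state st ->
  normal_state (factor_act A E iG g st).
Proof.
move=> [alt As _]; have [_ ho _] := alternating_splitsG alt.
rewrite /factor_act; set y := _ * g.
split=> /=; [|by have [] := residue_mem FG y|exact: residue_canon].
rewrite /cons_in; case: eqP => [_|s1]; first exact: alternating_tail.
split; last exact: alternating_tail.
by left; split=> //; exists (coset_rep A E iG y); rewrite (coset_rep_idem FG).
Qed.

Lemma factor_actH_normal h st : normal_state st ->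
  normal_state (factor_act A E iH h st).
Proof.
move=> [alt As _]; have [_ ho _] := alternating_splitsH alt.
rewrite /factor_act; set y := _ * h.
split=> /=; [|by have [] := residue_mem FH y|by rewrite amalgam1; exact: residue_canon].
rewrite /cons_in; case: eqP => [_|s1]; first exact: alternating_tail.
split; last exact: alternating_tail.
by right; split=> //; exists (coset_rep A E iH y); rewrite (coset_rep_idem FH).
Qed.

Lemma letter_act_normal x st : normal_state st -> normal_state (letter_act x st).
Proof.
move=> stP; have [[g _ <-]|[h _ <-]] := in_union x.
  by rewrite letter_actG; apply: factor_actG_normal.
by rewrite letter_actH//; apply: factor_actH_normal.
Qed.

Lemma word_act_normal u st : normal_state st -> normal_state (word_act u st).
Proof. by elim: u st => //= x u IHu st stP; apply: IHu; apply: letter_act_normal. Qed.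

(** The action factors through the amalgamated product, since it satisfies each
    of the defining relations. *)
Lemma word_act_cong u v : word_cong u v ->
  forall st, normal_state st -> word_act u st = word_act v st.
Proof.
elim=> {u v} //.
- by move=> u v _ IH st stP; rewrite IH.
- by move=> v u w _ IH1 _ IH2 st stP; rewrite IH1// IH2.
- move=> u1 u2 v1 v2 _ IH1 _ IH2 st stP.
  rewrite /word_act !foldl_cat -!/(word_act _ _) IH1// IH2//.
  exact: word_act_normal.
- move=> [q a] [alt /= As ac] /=; rewrite letter_actG.
  rewrite (factor_act_common FG)//=; last exact: (factor1 FG).
    by have [[b _ ba] _] := As; rewrite -ba (un_factorK FG) mulg1 ba ac.
  exact: alternating_splitsG.
- move=> g1 g2 st stP; rewrite /= !letter_actG (factor_actM FG)//.
  by case: stP => /alternating_splitsG.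
- move=> h1 h2 st stP; rewrite /= (letter_actH _ stP).
  rewrite !letter_actH//; last exact: factor_actH_normal.
  by rewrite (factor_actM FH)//; case: stP => /alternating_splitsH.
Qed.

Lemma letter_act_near x y st : normal_state st -> E x y ->
  letter_act x st = letter_act y st.
Proof.
move=> stP; have cross g h : E (iG g) (iH h) ->
    letter_act (iG g) st = letter_act (iH h) st.
  move=> /EGH[a [[b _ ba] [c _ ca]] [ga ah]].
  transitivity (letter_act a st).
    rewrite -ba !letter_actG; apply: (factor_act_near FG).
    by rewrite ba.
  rewrite -ca !letter_actH//; apply: (factor_act_near FH).
  by rewrite ca.
have [[g _ <-]|[h _ <-]] := in_union x; have [[g' _ <-]|[h' _ <-]] := in_union y.
- by rewrite !letter_actG; apply: (factor_act_near FG).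
- exact: cross.
- by move/Esym/cross.
- by rewrite !letter_actH//; apply: (factor_act_near FH).
Qed.

(** The action factors through the quotient amalgam; two congruent letters from
    different groups are compared through an element of [A]. *)
Lemma word_act_near u v st : normal_state st -> size u = size v ->
  (forall p, p \in zip u v -> E p.1 p.2) -> word_act u st = word_act v st.
Proof.
elim: u v st => [|x u IHu] [|y v] //= st stP [uv] near.
rewrite (letter_act_near stP (near (x, y) (mem_head _ _))); apply: IHu => //.
  exact: letter_act_normal.
by move=> p pP; apply: near; rewrite in_cons pP orbT.
Qed.

Definition base_state : seq U * U := ([::], canon_near A E (iG 1) (iG 1)).

Lemma base_near : A base_state.2 /\ E (iG 1) base_state.2.
Proof.
apply: (@xgetPex _ _ [set b | A b /\ E (iG 1) b]).
by exists (iG 1); split; [exact: (factor1 FG)|exact: (factor_refl FG)].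
Qed.

Lemma base_normal : normal_state base_state.
Proof.
have [Ab b1] := base_near; split=> //.
have [[g _ gb] _] := Ab; rewrite -gb in b1 *.
by rewrite -(canon_near_eq FG (iG 1) b1) -[LHS]/base_state.2 gb.
Qed.

Lemma letter_act_baseG g : letter_act (iG g) base_state =
  (cons_in iG (coset_rep A E iG g) [::], residue A E iG g).
Proof. by have [Ab b1] := base_near; rewrite letter_actG (factor_act_base FG). Qed.

Lemma letter_act_baseH h : letter_act (iH h) base_state =
  (cons_in iH (coset_rep A E iH h) [::], residue A E iH h).
Proof.
have [Ab b1] := base_near; rewrite letter_actH; last exact: base_normal.
by rewrite (factor_act_base FH)// -amalgam1.
Qed.

(** The images of [G] and [H] in the quotient amalgam are faithful and meet
    only in that of [A]: the image of the base point determines the decomposition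
    of a letter, and for letters of different groups both sequences must be
    empty, as a common representative would lie in [A]. *)
Lemma base_separates x y :
  letter_act x base_state = letter_act y base_state -> E x y.
Proof.
have cross g h : letter_act (iG g) base_state = letter_act (iH h) base_state ->
    E (iG g) (iH h).
  rewrite letter_act_baseG letter_act_baseH => -[qE aE].
  have [Ar gr] := residue_mem FG g; have [_ hr] := residue_mem FH h.
  move: qE; rewrite /cons_in; case: eqP => [g1|g1]; case: eqP => [h1|h1] //.
    move=> _; apply/EGH; exists (residue A E iG g) => //; split.
      by rewrite g1 invg1 mul1g in gr.
    by apply: Esym; rewrite aE; rewrite h1 invg1 mul1g in hr.
  move=> [sE]; case: (@rep_letterG_out (iG (coset_rep A E iG g))).
    by exists (coset_rep A E iG g); rewrite (coset_rep_idem FG).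
  by rewrite sE; exists (coset_rep A E iH h).
have [[g _ <-]|[h _ <-]] := in_union x; have [[g' _ <-]|[h' _ <-]] := in_union y.
- rewrite !letter_act_baseG => -[qE aE].
  have sE := congr1 (head_in iG) qE; rewrite !(head_in_cons FG)// in sE.
  apply: (factor_trans FG) (coset_rep_residue FG g) _.
  by rewrite sE aE; apply: (factor_sym FG); apply: coset_rep_residue.
- exact: cross.
- by move/esym/cross/Esym.
- rewrite !letter_act_baseH => -[qE aE].
  have sE := congr1 (head_in iH) qE; rewrite !(head_in_cons FH)// in sE.
  apply: (factor_trans FH) (coset_rep_residue FH h) _.
  by rewrite sE aE; apply: (factor_sym FH); apply: coset_rep_residue.
Qed.

Definition far_from_inter x : Prop := ~ (exists2 a, A a & E x a).

(** The new leading letter [b] is a representative in the same group as [x] and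
    not in the other one, so the next letter of a reduced word will again find a
    sequence that does not start in its group. *)
Lemma letter_act_far x st : normal_state st -> far_from_inter x ->
    (range iG x -> head_out iG st.1) -> (range iH x -> head_out iH st.1) ->
  exists2 b, (letter_act x st).1 = b :: st.1 &
    forall y, ~ same_factor x y ->
      (range iG y -> ~ range iG b) /\ (range iH y -> ~ range iH b).
Proof.
move=> stP; have [_ As _] := stP.
have [[g _ <-]|[h _ <-]] := in_union x => far hG hH.
  rewrite letter_actG; have [b br bE] := factor_act_far FG (hG (imageT _ _)) As far.
  exists b => // y ny; split; last by move=> _; apply: rep_letterG_out.
  by move=> yG; case: ny; left; split=> //; exists g.
rewrite letter_actH//; have [b br bE] := factor_act_far FH (hH (imageT _ _)) As far.
exists b => // y ny; split; first by move=> _; apply: rep_letterH_out.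
by move=> yG; case: ny; right; split=> //; exists h.
Qed.

Lemma word_act_reduced x u st : path (@switches _ _ U) x u -> normal_state st ->
    (range iG x -> head_out iG st.1) -> (range iH x -> head_out iH st.1) ->
    (forall y, y \in x :: u -> far_from_inter y) ->
  size (word_act (x :: u) st).1 = (size st.1 + size (x :: u))%N.
Proof.
elim: u x st => [|y u IHu] x st xu stP hG hH far;
  have [b bE bP] := letter_act_far stP (far x (mem_head _ _)) hG hH.
  by rewrite /= bE /= addn1.
move: xu => /= /andP[/asboolPn xy yu].
have [yG yH] := bP _ xy.
rewrite -/(word_act (y :: u) _) IHu//= ?bE//= ?addSnnS//.
  exact: letter_act_normal.
by move=> z zP; apply: far; rewrite in_cons zP orbT.
Qed.

End WordAction.

(** * The Graev distance of a distance on letters *)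

Section GraevDistance.
Variables (R : realType) (G H : groupType) (U : group_amalgam G H).
Variable d : U -> U -> R.
Hypothesis d_refl : forall x, d x x = 0.
Hypothesis d_sym : forall x y, d x y = d y x.
Implicit Types (f g : amalgamated_product U) (u v : seq U) (r : R).
Local Notation delta := (graev_dist d).

Lemma word_dist_ge0 u v : 0 <= word_dist d u v.
Proof.
rewrite /word_dist; elim: (zip u v) => [|p s IHs]; first by rewrite big_nil.
by rewrite big_cons le_max IHs orbT.
Qed.

Lemma word_dist_ltP u v r : 0 < r ->
  (word_dist d u v < r <-> forall p, p \in zip u v -> d p.1 p.2 < r).
Proof.
rewrite /word_dist => r0; elim: (zip u v) => [|p s IHs].
  by rewrite big_nil; split.
rewrite big_cons gt_max; split=> [/andP[pr /IHs sr] q|h].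
  by rewrite in_cons => /orP[/eqP ->|/sr].
rewrite h ?mem_head//=; apply/IHs => q qs; apply: h.
by rewrite in_cons qs orbT.
Qed.

Definition paired_words f g u v : Prop :=
  [/\ u != [::] /\ v != [::], word_prod u = f, word_prod v = g & size u = size v].

Lemma graev_dist_le f g u v : paired_words f g u v -> delta f g <= word_dist d u v.
Proof.
move=> [uv0 uf vg uv]; apply: ge_inf; last by exists u, v; split.
by exists 0 => _ [u' [v' [_ _ _ _ ->]]]; apply: word_dist_ge0.
Qed.

(** Padding with the letter [1] equalises lengths without changing products, so
    the infimum is over a nonempty set. *)
Lemma paired_words_exist f g : exists u v, paired_words f g u v.
Proof.
have [[u ->] [v ->]] := (word_class_surj f, word_class_surj g).
rewrite -!word_prodE; pose e := inG U 1%g.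
have pad w n : word_prod (w ++ nseq n e) = word_prod w.
  rewrite word_prod_cat; suff -> : word_prod (nseq n e) = 1%g by rewrite mulg1.
  have e1 : letter e = 1%g by apply/word_classP/word_cong_1.
  by elim: n => [|n IHn]; rewrite /word_prod ?big_nil//= big_cons e1 mul1g.
exists (u ++ nseq (size v).+1 e), (v ++ nseq (size u).+1 e).
split; rewrite ?pad //; first by rewrite -!size_eq0 !size_cat !size_nseq !addnS.
by rewrite !size_cat !size_nseq !addnS addnC.
Qed.

Lemma graev_dist_ge0 f g : 0 <= delta f g.
Proof.
apply: lb_le_inf; last by move=> _ [u [v [_ _ _ _ ->]]]; apply: word_dist_ge0.
by have [u [v [? ? ? ?]]] := paired_words_exist f g; exists (word_dist d u v), u, v.
Qed.

Lemma graev_dist_ltP f g r :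
  delta f g < r <-> exists u v, paired_words f g u v /\ word_dist d u v < r.
Proof.
split=> [/inf_lt[]|[u [v [uv]]]]; last first.
- by apply: le_lt_trans; apply: graev_dist_le.
- by move=> _ [u [v [? ? ? ? ->]]] h; exists u, v.
- by have [u [v [? ? ? ?]]] := paired_words_exist f g; exists (word_dist d u v), u, v.
Qed.

Lemma graev_distM f1 f2 g1 g2 r : delta f1 g1 < r -> delta f2 g2 < r ->
  delta (f1 * f2)%g (g1 * g2)%g < r.
Proof.
move=> h1; have r0 := le_lt_trans (graev_dist_ge0 f1 g1) h1.
move: h1 => /graev_dist_ltP[u1 [v1 [[[u10 v10] <- <- uv1] h1]]].
move=> /graev_dist_ltP[u2 [v2 [[_ <- <- uv2] h2]]].
apply/graev_dist_ltP; exists (u1 ++ u2), (v1 ++ v2); split.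
  split; rewrite ?word_prod_cat ?size_cat ?uv1 ?uv2//.
  by case: (u1) (v1) u10 v10 => [|? ?] [|? ?].
apply/word_dist_ltP => // p; rewrite zip_cat// mem_cat.
by move/(word_dist_ltP _ _ r0): h1 => h1; move/(word_dist_ltP _ _ r0): h2 => h2
   => /orP[/h1|/h2].
Qed.

Lemma graev_dist_refl f : delta f f = 0.
Proof.
apply/eqP; rewrite eq_le graev_dist_ge0 andbT leNgt; apply/negP => pos.
have [u [v [[u0 _] uf _ _]]] := paired_words_exist f f.
have : delta f f < delta f f; last by rewrite ltxx.
apply/graev_dist_ltP; exists u, u; split=> //; apply/word_dist_ltP => //.
by elim: (u) => //= x s IHs p; rewrite in_cons => /orP[/eqP ->|/IHs//]; rewrite d_refl.
Qed.

Lemma graev_dist_symm_le f g : delta g f <= delta f g.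
Proof.
rewrite leNgt; apply/negP => h.
have r0 := le_lt_trans (graev_dist_ge0 _ _) h.
have : delta g f < delta g f; last by rewrite ltxx.
move: {-2}h => /graev_dist_ltP[u [v [[[u0 v0] uf vg uv] huv]]].
apply/graev_dist_ltP; exists v, u; split=> //.
apply/word_dist_ltP => // p pvu; rewrite d_sym.
apply: ((word_dist_ltP _ _ r0).1 huv (p.2, p.1)).
elim: (u) (v) pvu {u0 v0 uf vg uv huv} => [|x s IHs] [|y t] //=.
by rewrite !in_cons => /orP[/eqP -> /=|/IHs ->]; rewrite ?eqxx ?orbT.
Qed.

Lemma graev_dist_mull f g1 g2 : delta (f * g1)%g (f * g2)%g = delta g1 g2.
Proof.
have le k h1 h2 : delta (k * h1)%g (k * h2)%g <= delta h1 h2.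
  rewrite leNgt; apply/negP => h.
  have := graev_distM (f1 := k) (g1 := k) _ h; rewrite graev_dist_refl.
  by rewrite ltxx => /(_ (le_lt_trans (graev_dist_ge0 _ _) h)).
apply/eqP; rewrite eq_le le /=.
by rewrite -{1}(mulKg f g1) -{1}(mulKg f g2) le.
Qed.

Lemma graev_dist_mulr f g1 g2 : delta (g1 * f)%g (g2 * f)%g = delta g1 g2.
Proof.
have le k h1 h2 : delta (h1 * k)%g (h2 * k)%g <= delta h1 h2.
  rewrite leNgt; apply/negP => h.
  have := graev_distM (f2 := k) (g2 := k) h; rewrite graev_dist_refl.
  by rewrite ltxx => /(_ (le_lt_trans (graev_dist_ge0 _ _) h)).
apply/eqP; rewrite eq_le le /=.
by rewrite -{1}(mulgK f g1) -{1}(mulgK f g2) le.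
Qed.

(** After right translation by [h^-1], the bound on products applies to
    [f = (f h^-1) h] and [g = 1 g]. *)
Lemma graev_dist_le_max f g h : delta f g <= Num.max (delta f h) (delta h g).
Proof.
rewrite leNgt gt_max; apply/negP => /andP[fh hg].
have fh1 : delta (f * h^-1)%g 1%g < delta f g.
  by rewrite -(graev_dist_mulr h) mulgVK mul1g.
by have := graev_distM fh1 hg; rewrite mulgVK mul1g ltxx.
Qed.

Lemma graev_dist_letter_le x y : 0 <= d x y -> delta (letter x) (letter y) <= d x y.
Proof.
move=> d_ge0; apply: (@le_trans _ _ (word_dist d [:: x] [:: y])).
  by apply: graev_dist_le; split=> //; rewrite /word_prod big_seq1.
by rewrite /word_dist /= big_cons big_nil max_l.
Qed.

End GraevDistance.

(** * The Graev distance of the amalgamated distance *)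

Section AmalgamDistance.
Variables (R : realType) (G H : groupType) (U : group_amalgam G H).
Variables (dG : G -> G -> R) (dH : H -> H -> R).
Hypothesis dG_um : is_ultrametric dG.
Hypothesis dG_inv : two_sided_invariant dG.
Hypothesis dH_um : is_ultrametric dH.
Hypothesis dH_inv : two_sided_invariant dH.
Hypothesis dGH : forall g1 g2 h1 h2, inG U g1 = inH U h1 -> inG U g2 = inH U h2 ->
  dG g1 g2 = dH h1 h2.
Local Notation d := (amalgam_dist U dG dH).
Local Notation A := (amalgam_inter U).
Local Notation delta := (graev_dist d).
Implicit Types (x y : U) (r : R).

Lemma amalgam_dist_ge0 x y : 0 <= d x y.
Proof.
have cross g h : 0 <= amalgam_cross U dG dH g h.
  apply: lb_le_inf.
    by exists (Num.max (dG g 1%g) (dH 1%g h)), (1%g, 1%g) => //; apply: amalgam1.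
  by move=> _ [a _ <-]; rewrite le_max (um_ge0 dG_um).
have [[g _ <-]|[h _ <-]] := in_union x; have [[g' _ <-]|[h' _ <-]] := in_union y.
- by rewrite amalgam_dist_GG; apply: um_ge0.
- by rewrite amalgam_dist_GH.
- by rewrite amalgam_dist_HG.
- by rewrite amalgam_dist_HH//; apply: um_ge0.
Qed.

Lemma amalgam_dist_sym x y : d x y = d y x.
Proof.
have [[g _ <-]|[h _ <-]] := in_union x; have [[g' _ <-]|[h' _ <-]] := in_union y.
- by rewrite !amalgam_dist_GG (um_sym dG_um).
- by rewrite amalgam_dist_GH// amalgam_dist_HG.
- by rewrite amalgam_dist_GH// amalgam_dist_HG.
- by rewrite !amalgam_dist_HH// (um_sym dH_um).
Qed.

Lemma amalgam_dist_refl x : d x x = 0.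
Proof.
have [[g _ <-]|[h _ <-]] := in_union x.
  by rewrite amalgam_dist_GG (um_eq0 dG_um g g).2.
by rewrite amalgam_dist_HH// (um_eq0 dH_um h h).2.
Qed.

Lemma inter_dist_lt r g h :
  d (inG U g) (inH U h) < r <->
  exists2 a, A a & d (inG U g) a < r /\ d a (inH U h) < r.
Proof.
rewrite amalgam_dist_GH//; split=> [/inf_lt[]|].
- by exists (Num.max (dG g 1%g) (dH 1%g h)), (1%g, 1%g) => //; apply: amalgam1.
- move=> _ [[b c] /= bc <-]; rewrite gt_max => /andP[gb ch].
  exists (inG U b); first by split; [exists b|exists c].
  by rewrite amalgam_dist_GG bc amalgam_dist_HH.
- move=> [_ [[b _ <-] [c _ cb]]]; rewrite amalgam_dist_GG -cb amalgam_dist_HH//.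
  move=> [gb ch]; apply: (@le_lt_trans _ _ (Num.max (dG g b) (dH c h))).
    apply: ge_inf; last by exists (b, c).
    by exists 0 => _ [a _ <-]; rewrite le_max (um_ge0 dG_um).
  by rewrite gt_max gb.
Qed.

Lemma congruent_factorG r : 0 < r ->
  congruent_factor A (fun x y => d x y < r) (inG U).
Proof.
move=> r0; split; rewrite ?amalgam_dist_GG.
- exact: inG_inj.
- by move=> a [].
- by split; [exists 1%g|exists 1%g => //; rewrite -amalgam1].
- move=> x y [_ [h _ hx]] [_ [k _ ky]]; split; first by exists (x * y)%g.
  by exists (h * k)%g => //; apply/esym/amalgamM.
- move=> x [_ [h _ hx]]; split; first by exists x^-1%g.
  by exists h^-1%g => //; apply/esym/amalgamV.
- by move=> x; rewrite amalgam_dist_refl.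
- by move=> x y; rewrite amalgam_dist_sym.
- move=> x y z; rewrite !amalgam_dist_GG => xy yz.
  by apply: le_lt_trans (um_le_max dG_um _ _ y) _; rewrite gt_max xy.
- by move=> z x y; rewrite !amalgam_dist_GG dG_inv.1.
- by move=> z x y; rewrite !amalgam_dist_GG dG_inv.2.
Qed.

Lemma congruent_factorH r : 0 < r ->
  congruent_factor A (fun x y => d x y < r) (inH U).
Proof.
move=> r0; split.
- exact: inH_inj.
- by move=> a [].
- by split; [exists 1%g => //; rewrite amalgam1|exists 1%g].
- move=> x y [[h _ hx] _] [[k _ ky] _]; split; last by exists (x * y)%g.
  by exists (h * k)%g => //; apply: amalgamM.
- move=> x [[h _ hx] _]; split; last by exists x^-1%g.
  by exists h^-1%g => //; apply: amalgamV.
- by move=> x; rewrite amalgam_dist_refl.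
- by move=> x y; rewrite amalgam_dist_sym.
- move=> x y z; rewrite !amalgam_dist_HH// => xy yz.
  by apply: le_lt_trans (um_le_max dH_um _ _ y) _; rewrite gt_max xy.
- by move=> z x y; rewrite !amalgam_dist_HH// dH_inv.1.
- by move=> z x y; rewrite !amalgam_dist_HH// dH_inv.2.
Qed.

(** Elements at distance less than [r] have the same image in the quotient by the
    balls of radius [r]. *)
Lemma graev_dist_word_act (u v : seq U) r :
  delta (word_prod u) (word_prod v) < r ->
  let E x y : Prop := d x y < r in
  word_act E u (base_state E) = word_act E v (base_state E).
Proof.
move=> uv E.
have r0 := le_lt_trans (graev_dist_ge0 _ _ _) uv.
have FG := congruent_factorG r0; have FH := congruent_factorH r0.
have Esym x y : E x y -> E y x by rewrite /E amalgam_dist_sym.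
have bn := base_normal FG.
have act_eq w w' : word_prod w = word_prod w' ->
    word_act E w (base_state E) = word_act E w' (base_state E).
  by rewrite !word_prodE => /word_classP ww'; apply: (word_act_cong FG FH ww').
have [u' [v' [[_ /act_eq <- /act_eq <- uv'] h]]] :=
  (graev_dist_ltP _ _ _ _).1 uv.
apply: (word_act_near FG FH Esym (@inter_dist_lt r)) => //.
exact/word_dist_ltP.
Qed.

Lemma graev_dist_letter x y : delta (letter x) (letter y) = d x y.
Proof.
apply/eqP; rewrite eq_le graev_dist_letter_le//=; last exact: amalgam_dist_ge0.
rewrite leNgt; apply/negP => lt_xy.
have r0 := le_lt_trans (graev_dist_ge0 _ _ _) lt_xy.
have := @graev_dist_word_act [:: x] [:: y] (d x y).
rewrite /word_prod !big_seq1 => /(_ lt_xy) /= actE.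
have FG := congruent_factorG r0; have FH := congruent_factorH r0.
have : d x y < d x y; last by rewrite ltxx.
apply: (base_separates FG FH _ (@inter_dist_lt _) actE) => a b.
by rewrite amalgam_dist_sym.
Qed.

(** What closedness of [A] in [G] and in [H] provides. *)
Hypothesis inter_far : forall x, ~ A x -> exists2 r, 0 < r & forall a, A a -> r <= d x a.

Lemma letters_far (u : seq U) : (forall x, x \in u -> ~ A x) ->
  exists2 r, 0 < r & forall x a, x \in u -> A a -> r <= d x a.
Proof.
elim: u => [|x u IHu] nA; first by exists 1.
have [r r0 rP] : exists2 r, 0 < r & forall x a, x \in u -> A a -> r <= d x a.
  by apply: IHu => y yu; apply: nA; rewrite in_cons yu orbT.
have [s s0 sP] := inter_far (nA x (mem_head _ _)).
exists (Num.min r s); first by rewrite lt_min r0.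
move=> y a; rewrite in_cons ge_min => /orP[/eqP -> /sP ->|yu Aa].
  by rewrite orbT.
by rewrite rP.
Qed.

(** A reduced word of length at least two, taken at a radius for which its letters
    stay away from [A], moves the base point, whereas the empty word fixes it. *)
Lemma graev_dist_eq1 (f : amalgamated_product U) : delta f 1%g = 0 -> f = 1%g.
Proof.
have [u srt <-] := reduced_word f.
have one : letter (inG U 1%g) = 1%g by apply/word_classP/word_cong_1.
case: u srt => [_ _|x [_|y u xyu]]; first by rewrite /word_prod big_nil.
  rewrite /word_prod big_seq1 -one graev_dist_letter.
  have [[g _ <-]|[h _ <-]] := in_union x.
    by rewrite amalgam_dist_GG => /(um_eq0 dG_um) ->.
  by rewrite amalgam1 amalgam_dist_HH// => /(um_eq0 dH_um) ->.
move=> f0; have [r r0 far] := letters_far (switches_notin_inter xyu isT).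
have := @graev_dist_word_act (x :: y :: u) [::] r.
rewrite {2}/word_prod big_nil f0 => /(_ r0) /= actE.
have FG := congruent_factorG r0; have FH := congruent_factorH r0.
have farE z : z \in x :: y :: u -> far_from_inter (fun a b => d a b < r) z.
  by move=> /far zfar [a Aa]; rewrite ltNge zfar.
have := word_act_reduced FG FH xyu (base_normal FG) (fun=> I) (fun=> I) farE.
by rewrite /= actE.
Qed.

Lemma graev_dist_ultrametric : is_ultrametric delta.
Proof.
split=> [f g|f g|f g|f g h].
- exact: graev_dist_ge0.
- split=> [fg0|->]; last exact/graev_dist_refl/amalgam_dist_refl.
  apply/(mulIg g^-1%g); rewrite mulgV; apply: graev_dist_eq1.
  by rewrite -(mulgV g) graev_dist_mulr//; apply: amalgam_dist_refl.
- by apply/eqP; rewrite eq_le !graev_dist_symm_le//; apply: amalgam_dist_sym.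
- exact: (graev_dist_le_max amalgam_dist_refl).
Qed.

End AmalgamDistance.

(** The complement of a closed set contains a ball around each of its points. *)
Lemma closed_inter_far (R : realType) (K : topologicalGroupType)
    (dK : K -> K -> R) (B : set K) (x : K) :
  compatible_metric dK -> closed B -> ~ B x ->
  exists2 r, 0 < r & forall b, B b -> r <= dK x b.
Proof.
move=> /(_ x) nbhsE clB nBx.
have : nbhs x (~` B) by apply: open_nbhs_nbhs; split=> //; apply: closed_openC.
rewrite nbhsE => -[r r0 rB]; exists r => // b Bb.
by rewrite leNgt; apply/negP => /rB; apply.
Qed.

Theorem theorem2p13 (R : realType) (G H : topologicalGroupType)
    (dG : G -> G -> R) (dH : H -> H -> R) (U : group_amalgam G H)
    (dG_ultrametric : is_ultrametric dG)
    (dG_invariant : two_sided_invariant dG)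
    (dG_compatible : compatible_metric dG)
    (dH_ultrametric : is_ultrametric dH)
    (dH_invariant : two_sided_invariant dH)
    (dH_compatible : compatible_metric dH)
    (A_closed_G : closed (inG U @^-1` amalgam_inter U))
    (A_closed_H : closed (inH U @^-1` amalgam_inter U))
    (dG_dH_agree : forall (g1 g2 : G) (h1 h2 : H),
      inG U g1 = inH U h1 -> inG U g2 = inH U h2 -> dG g1 g2 = dH h1 h2) :
  let d := amalgam_dist U dG dH in
  let delta := graev_dist d in
  [/\ is_ultrametric delta,
      two_sided_invariant delta &
      forall x y : U, delta (letter x) (letter y) = d x y].
Proof.
move=> d delta.
have d_refl : forall x, d x x = 0 by apply: amalgam_dist_refl.
split; last exact: graev_dist_letter.
  apply: graev_dist_ultrametric => // x nAx.
  have [[g _ gx]|[h _ hx]] := in_union x; subst x.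
    have [r r0 rP] := closed_inter_far dG_compatible A_closed_G nAx.
    exists r => // _ [[b _ <-] bH]; rewrite amalgam_dist_GG; apply: rP.
    by split=> //; exists b.
  have [r r0 rP] := closed_inter_far dH_compatible A_closed_H nAx.
  exists r => // a [bG [b _ be]]; rewrite -be in bG *.
  by rewrite amalgam_dist_HH//; apply: rP; split=> //; exists b.
by split=> g x y; [apply: graev_dist_mull|apply: graev_dist_mulr].
Qed.
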